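(* Let $F$ be a $\mathcal K$-Gårding polynomial on $W$, let $P_1,\dots,P_m\in\mathcal K$ and $A\in W$, and set $$L(x)=A+\sum_{i=1}^mx_iP_i\quad(x\in\mathbb R^m),\qquad f=F\circ L.$$ If $L(\mathbb R^m)\cap\mathcal C_F^{\mathcal K}\ne\varnothing$, then $f$ is Gårding. This holds, in particular, if $A\in\mathcal C_F^{\mathcal K}$ or $\sum_iP_i\in\operatorname{int}\mathcal K$. If $A\in\mathcal C_F^{\mathcal K}$, then $f$ is Gårding and has nonnegative coefficients.
   Context: $W$ is a finite-dimensional real vector space and $\mathcal K\subsetneq W$ a closed convex cone with nonempty interior. $\partial_PF$ denotes the directional derivative of $F$ along $P$. A set $\mathcal U\subseteq W$ satisfies the $\mathcal K$-conic ray test if $\mathcal U+\mathcal K\subseteq\mathcal U$. For nonzero $F\in\mathbb R[W]$, $\{F>0\}$ has at most one connected component satisfying the $\mathcal K$-conic ray test; if it exists it is called the $\mathcal K$-Gårding component $\mathcal C_F^{\mathcal K}$ (for a positive constant $F$, $\mathcal C_F^{\mathcal K}=W$). A nonzero $F$ is $\mathcal K$-Gårding (recursively on degree) if $\mathcal C_F^{\mathcal K}$ exists and, whenever $\deg F\ge1$, for every $P\in\mathcal K$ with $\partial_PF\not\equiv0$ the polynomial $\partial_PF$ is $\mathcal K$-Gårding and $\mathcal C_F^{\mathcal K}\subseteq\mathcal C_{\partial_PF}^{\mathcal K}$. A polynomial on $\mathbb R^m$ is called Gårding if it is $\mathcal K$-Gårding for $W=\mathbb R^m$ and $\mathcal K$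 the closed nonnegative orthant. (In the ordinary theory it is equivalent to require the recursive condition only for the coordinate derivatives $\partial_i$; this is the known recursive characterization of Gårding polynomials, and Gårding polynomials are closed under nonzero nonnegative directional derivatives with nested components.) *)

(* Defs.v *)
From HB Require Import structures.
From mathcomp Require Import all_boot all_order all_algebra.
From mathcomp Require Import all_classical all_reals all_analysis.
From mathcomp.multinomials Require mpoly.

Set Implicit Arguments.
Unset Strict Implicit.
Unset Printing Implicit Defensive.

Import Order.TTheory GRing.Theory Num.Theory.
Import numFieldNormedType.Exports.
(* The notations of mpoly clash with those of analysis. *)
Import -(notations) mpoly.

Local Open Scope classical_set_scope.
Local Open Scope ring_scope.

(* All norms on a finite-dimensional real vector space are equivalent, so the
   norm carried by such a W only serves to give access to its canonical
   topology (interior, closedness, connected components, derivatives). *)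
#[short(type="finNormedModType")]
HB.structure Definition FinNormedModule (R : numFieldType) :=
  {W of Vector R W & NormedModule R W}.

HB.instance Definition _ (R : numFieldType) (m n : nat) :=
  Vector.on 'M[R]_(m, n).

Section Garding.
Context {R : realType} {W : finNormedModType R}.
Implicit Types (K U C : set W) (F : W -> R).

Definition closed_convex_cone K : Prop :=
  [/\ closed K, convex_set K & forall (t : R) x, 0 <= t -> K x -> K (t *: x)].

(* Elements of R[W] are handled as functions on W; as R is infinite, [p] is
   determined by [F]. *)
Definition represents (p : mpoly (\dim {:W}) R) F : Prop :=
  forall w, F w = meval (fun i => coord (vbasis {:W}) i w) p.

Definition polynomial_function F : Prop := exists p, represents p F.

(* [msize] is the total degree plus one, and 0 for the zero polynomial. *)
Definition positive_degree F : Prop :=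
  exists p, represents p F /\ (1 < msize p)%N.

Definition conic_ray_test K U : Prop :=
  forall u k, U u -> K k -> U (u + k).

Definition is_component (A C : set W) : Prop :=
  exists2 x, A x & C = connected_component A x.

Definition is_garding_component K F C : Prop :=
  is_component [set w | 0 < F w] C /\ conic_ray_test K C.

(* When K is a convex cone with nonempty interior there is at most one [C] in
   this union, which is therefore the Garding component if that exists, and
   empty otherwise. *)
Definition garding_component K F : set W :=
  \bigcup_(C in [set C | is_garding_component K F C]) C.

(* The recursion on the degree is well-founded, since a directional derivative
   of a polynomial of positive degree has smaller degree; the least fixed point
   is thus the only solution of the recursive definition. *)
Inductive garding_for K F : Prop :=
  Garding_for of
    polynomial_function F
  & F <> cst 0
  & (exists C, is_garding_component K F C)
  & (positive_degree F -> forall P, K P -> 'D_P F <> cst 0 ->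
       garding_for K ('D_P F))
  & (positive_degree F -> forall P, K P -> 'D_P F <> cst 0 ->
       garding_component K F `<=` garding_component K ('D_P F)).

End Garding.

Definition nonneg_orthant (R : realType) (m : nat) : set 'rV[R]_m :=
  [set x | forall i, 0 <= x ord0 i].

Definition garding (R : realType) (m : nat) (f : 'rV[R]_m -> R) : Prop :=
  garding_for (@nonneg_orthant R m) f.

Definition has_nonneg_coefficients (R : realType) (m : nat)
    (f : 'rV[R]_m -> R) : Prop :=
  exists p : mpoly m R,
    (forall x, f x = meval (fun i => x ord0 i) p) /\
    (forall a : multinom m, 0 <= mcoeff a p).

(* Main.v *)
Require Import Defs.
From HB Require Import structures.
From mathcomp Require Import all_boot all_order all_algebra.
From mathcomp Require Import all_classical all_reals all_analysis.
From mathcomp Require Import lra.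
From mathcomp.multinomials Require mpoly.

Set Implicit Arguments.
Unset Strict Implicit.
Unset Printing Implicit Defensive.

Import Order.TTheory GRing.Theory Num.Theory.
Import numFieldNormedType.Exports.
Import -(notations) mpoly.

Local Open Scope classical_set_scope.
Local Open Scope ring_scope.

(** Write L = A + M with M linear. The set U = L^-1(C_F) is stable under adding
    nonnegative vectors, because M maps them into K, and f = F \o L is positive
    on U. If U is nonempty, it is the Garding component of f:
    - a component of {f > 0} is connected, so its image under L lies in a
      single component of {F > 0}; hence the component of a point of U stays
      in U, and it passes the ray test, since u + t v stays in U for t >= 0
      and v nonnegative;
    - any two points of the domain can be moved to a common point by adding
      nonnegative vectors, so a second component passing the ray test would
      meet U, and two points of U lie in the same component.
    This is [garding_component_affine_comp].

    Differentiation commutes with the pullback: D_v (F \o L) = (D_(M v) F) \o L,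
    and M v lies in K when v is nonnegative. So the recursive conditions for f
    are those for F, read through L; nestedness of the components is preserved
    because taking preimages is monotone, and it also shows that L still meets
    the component of D_(M v) F. Induction on the proof that F is Garding gives
    [garding_for_affine_comp].

    If S = \sum_i P i is interior to K and c lies in C_F, then for small e > 0
    the vector S + e (A - c) lies in K, whence A + e^-1 S = c + e^-1 (S + e (A - c))
    lies in C_F + K, which is contained in C_F.

    If A lies in C_F, then 0 lies in the component of f, hence in the component
    of every nonzero iterated partial derivative of f. All these derivatives are
    therefore nonnegative at 0, and up to positive factors they are the
    coefficients of f ([garding_mcoeff_ge0]). *)

(** * Connected components and rays *)

Lemma connected_component_preimage (T U : topologicalType) (f : T -> U)
    (S : set U) x y :
  continuous f -> connected_component (f @^-1` S) x y ->
  connected_component S (f x) (f y).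
Proof.
move=> fc [C [Cx CS Cc] Cy].
have fCc : connected (f @` C).
  exact/(connected_continuous_connected Cc)/continuous_subspaceT.
apply: (connected_component_max _ _ fCc); first by exists x.
  by move=> _ [z Cz <-]; exact: CS.
by exists y.
Qed.

Lemma segment_connected_component (R : realType) (V : normedModType R)
    (S : set V) (x v : V) :
  (forall t, 0 <= t -> S (x + t *: v)) -> connected_component S x (x + v).
Proof.
move=> Sxv; set g : R -> V := fun t => x + t *: v.
have gc : continuous g.
  by move=> t; apply: cvgD; [exact: cvg_cst|exact: scalel_continuous].
have := @connected_component_preimage _ _ g S 0 1 gc.
rewrite /g scale0r addr0 scale1r; apply.
apply: (connected_component_max _ _ (@segment_connected R 0 1)) => /=.
- by rewrite in_itv/= lexx ler01.
- by move=> t /=; rewrite in_itv/= => /andP[t0 _]; exact: Sxv.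
- by rewrite in_itv/= lexx ler01.
Qed.

Lemma is_garding_component_gt0 (R : realType) (W : finNormedModType R)
    (K : set W) (F : W -> R) C w :
  is_garding_component K F C -> C w -> 0 < F w.
Proof. by move=> [[y _ ->] _] /connected_component_sub. Qed.

(** * Pulling back Garding components along an affine map *)

Section AffinePullback.
Context {R : realType} {V W : finNormedModType R}.
Variables (J : set V) (K : set W) (M : {linear V -> W}) (A : W).
Hypothesis Mcont : continuous M.
Hypothesis Jscale : forall (t : R) v, 0 <= t -> J v -> J (t *: v).
Hypothesis Jgen : forall v, exists a b, [/\ J a, J b & v = a - b].
Hypothesis MJK : forall v, J v -> K (M v).
Let L (v : V) : W := A + M v.

Let Lcont : continuous L.
Proof. by move=> v; apply: cvgD; [exact: cvg_cst|exact: Mcont]. Qed.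

Let LD u v : L (u + v) = L u + M v.
Proof. by rewrite /L linearD addrA. Qed.

(** The difference quotients of the two sides are the same functions of the
    step, since L (h v + x) = h M v + L x. *)
Lemma derive_affine_comp (F : W -> R) (v : V) :
  'D_v (F \o L) = 'D_(M v) F \o L.
Proof.
apply/funext => x; rewrite /derive /=.
suff -> : (fun h => h^-1 *: (F (L (h *: v + x)) - F (L x))) =
  (fun h => h^-1 *: (F (h *: M v + L x) - F (L x))) by [].
by apply/funext => h; rewrite [h *: v + x]addrC LD linearZ [L x + _]addrC.
Qed.

(** The ray test for [C] keeps the image of the whole ray from [x] along [v]
    inside [C], where [F] is positive. *)
Lemma is_garding_component_ray (F : W -> R) C x v :
  is_garding_component K F C -> C (L x) -> J v ->
  connected_component [set u | 0 < (F \o L) u] x (x + v).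
Proof.
move=> gC CLx Jv; apply: segment_connected_component => t t0 /=.
rewrite LD; apply: (is_garding_component_gt0 gC).
by apply: gC.2 => //; apply: MJK; apply: Jscale.
Qed.

(** [L] maps the component of [x] into a connected part of the positivity set of
    [F] containing [L x], hence into [C]; at each of its points the previous
    lemma applies. *)
Lemma is_garding_component_affine_comp (F : W -> R) C x :
  is_garding_component K F C -> C (L x) ->
  is_garding_component J (F \o L)
    (connected_component [set u | 0 < (F \o L) u] x).
Proof.
move=> gC CLx; have [[y Fy Cy] _] := gC.
split.
  by exists x => //=; exact: is_garding_component_gt0 gC CLx.
move=> u v xu Jv; apply: (connected_component_trans xu).
apply: (is_garding_component_ray gC) => //.
rewrite Cy in CLx *; apply: (connected_component_trans CLx).
exact: connected_component_preimage.
Qed.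

(** Adding elements of [J] to [x] and to [y] leads to a common point, which
    joins them within the positivity set; this is where the uniqueness of
    Garding components comes from. *)
Lemma is_garding_component_affine_comp_sub (F : W -> R) C C' x y :
  is_garding_component K F C -> C (L x) ->
  is_garding_component J (F \o L) C' -> C' y -> C (L y).
Proof.
move=> gC CLx [[z Fz C'z] ray'] C'y.
have [[w Fw Cw] _] := gC.
have [a [b [Ja Jb xy]]] := Jgen (x - y).
have e : y + a = x + b.
  by rewrite -[x](subrK y) xy addrAC subrK addrC.
have : connected_component [set u | 0 < (F \o L) u] x (x + b).
  exact: (is_garding_component_ray gC).
(* The point y + a = x + b is in both components, of y and of x. *)
have : C' (y + a) by exact: ray'.
rewrite e C'z in C'y * => zxb xxb.
have xy' : connected_component [set u | 0 < (F \o L) u] x y.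
  apply: (connected_component_trans xxb).
  by apply: (connected_component_trans _ C'y); exact: connected_component_sym.
rewrite Cw in CLx *; apply: (connected_component_trans CLx).
exact: connected_component_preimage.
Qed.

Lemma garding_component_affine_comp (F : W -> R) :
  range L `&` garding_component K F !=set0 ->
  garding_component J (F \o L) = L @^-1` garding_component K F.
Proof.
move=> [_ [[x _ <-] [C gC CLx]]]; apply/seteqP; split => y.
  by move=> [C' gC' C'y]; exists C => //;
    exact: (is_garding_component_affine_comp_sub gC CLx gC').
move=> [D gD DLy].
exists (connected_component [set u | 0 < (F \o L) u] y).
  exact: (is_garding_component_affine_comp gD).
by apply: connected_component_refl; exact: is_garding_component_gt0 gD DLy.
Qed.

End AffinePullback.

(** * Polynomial functions *)

Lemma meval_comp_mpoly (R : comNzRingType) n k (u : 'I_n -> mpoly k R)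
    (v : 'I_k -> R) (p : mpoly n R) :
  meval v (comp_mpoly [tuple u i | i < n] p) = meval (fun i => meval v (u i)) p.
Proof. by rewrite comp_mpoly_meval; apply: meval_eq => i; rewrite tnth_mktuple. Qed.

(** The coordinates [c] with respect to [b] are arbitrary, so that the lemma
    serves both for the chosen basis of [V] and for the standard coordinates of
    row vectors. *)
Lemma polynomial_function_comp_affine (R : realType) (V W : finNormedModType R)
   k (F : W -> R) (M : {linear V -> W}) (A : W) (c : V -> 'I_k -> R)
   (b : 'I_k -> V) :
  (forall v, v = \sum_(i < k) c v i *: b i) ->
  polynomial_function F ->
  exists p : mpoly k R, forall v, F (A + M v) = meval (c v) p.
Proof.
move=> cb [p Fp].
pose u i : mpoly k R := mpolyC k (coord (vbasis {:W}) i A) +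
  \sum_(j < k) coord (vbasis {:W}) i (M (b j)) *: mpolyX R (mnm1 j).
exists (comp_mpoly [tuple u i | i < _] p) => v.
rewrite meval_comp_mpoly Fp; apply: meval_eq => i.
rewrite /u mevalD mevalC linearD /=; congr (_ + _).
rewrite {1}(cb v) !linear_sum /=; apply: eq_bigr => j _.
by rewrite !linearZ /= mevalXU mulrC.
Qed.

Lemma derive_neq0_positive_degree (R : realType) (W : finNormedModType R)
    (F : W -> R) P :
  polynomial_function F -> 'D_P F <> cst 0 -> positive_degree F.
Proof.
move=> [p Fp] DF; exists p; split=> //; rewrite ltnNge; apply/negP => p1.
apply: DF; rewrite (_ : F = cst (mcoeff mnm0 p)).
  by apply/funext => x; exact: derive_cst.
by apply/funext => x; rewrite Fp (msize1_polyC p1) mevalC mcoeffC eqxx mulr1.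
Qed.

(** * Garding polynomials are stable under affine pullback *)

Theorem garding_for_affine_comp (R : realType) (V W : finNormedModType R)
    (J : set V) (K : set W) (M : {linear V -> W}) (A : W) (F : W -> R) :
  continuous M ->
  (forall (t : R) v, 0 <= t -> J v -> J (t *: v)) ->
  (forall v, exists a b, [/\ J a, J b & v = a - b]) ->
  (forall v, J v -> K (M v)) ->
  garding_for K F ->
  range (fun v => A + M v) `&` garding_component K F !=set0 ->
  garding_for J (F \o (fun v => A + M v)).
Proof.
move=> Mc Js Jg MJK; elim=> {}F Fpol F0 Fex IH1 IH2 IH3 ne.
have pol : polynomial_function (F \o (fun v => A + M v)).
  apply: polynomial_function_comp_affine Fpol => v.
  exact/coord_vbasis/memvf.
have dne v : J v -> 'D_v (F \o (fun v => A + M v)) <> cst 0 ->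
    [/\ positive_degree F, K (M v) & 'D_(M v) F <> cst 0].
  move=> Jv; rewrite derive_affine_comp => D0.
  have D0' : 'D_(M v) F <> cst 0 by move=> e; apply: D0; rewrite e.
  split => //; [exact: derive_neq0_positive_degree D0'|exact: MJK].
have sub v : J v -> 'D_v (F \o (fun v => A + M v)) <> cst 0 ->
    range (fun v => A + M v) `&` garding_component K ('D_(M v) F) !=set0.
  move=> Jv D0; have [dF Kv DF] := dne _ Jv D0.
  by have [w [Lw Cw]] := ne; exists w; split=> //; exact: (IH3 dF _ Kv DF).
have [_ [[x _ <-] [C gC CLx]]] := ne.
have gx := is_garding_component_affine_comp Mc Js MJK gC CLx.
apply: Garding_for.
- exact: pol.
- move=> f0; have [z + _] := gx.1.
  by rewrite /mkset f0 ltxx.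
- by eexists; exact: gx.
- move=> _ v Jv D0; have [dF Kv DF] := dne _ Jv D0.
  by rewrite derive_affine_comp; apply: IH2 => //; exact: sub.
- move=> _ v Jv D0; have [dF Kv DF] := dne _ Jv D0.
  rewrite derive_affine_comp !(garding_component_affine_comp Mc Js Jg MJK) //.
    by apply: preimage_subset; exact: IH3.
  exact: sub.
Qed.

(** * Nonnegativity of the coefficients *)

(** Polynomials for which this holds are stable under sums and products, and
    contain the constants and the variables. *)
Lemma is_derive_meval (R : realType) m (p : mpoly m R) (i : 'I_m)
    (x : 'rV[R]_m) :
  is_derive x (delta_mx ord0 i) (fun y : 'rV[R]_m => meval (fun j => y ord0 j) p)
    (meval (fun j => x ord0 j) (mderiv i p)).
Proof.
pose D (q : mpoly m R) :=
  is_derive x (delta_mx ord0 i) (fun y : 'rV[R]_m => meval (fun j => y ord0 j) q)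
    (meval (fun j => x ord0 j) (mderiv i q)).
have DC c : D (mpolyC m c).
  rewrite /D mderivC meval0.
  under eq_fun do rewrite mevalC.
  exact: is_derive_cst.
have DM q r : D q -> D r -> D (q * r).
  rewrite /D => Dq Dr; rewrite mderivM mevalD !mevalM.
  under eq_fun do rewrite mevalM.
  apply: is_derive_eq (is_deriveM Dq Dr) _.
  by rewrite /GRing.scale /= addrC mulrC [X in _ + X]mulrC.
have DD q r : D q -> D r -> D (q + r).
  rewrite /D => Dq Dr; rewrite mderivD mevalD.
  under eq_fun do rewrite mevalD.
  exact: is_deriveD.
have DX j : D (mpolyX R (mnm1 j)).
  rewrite /D.
  under eq_fun do rewrite mevalXU.
  rewrite mderivX mnm1E mevalZ.
  have -> : (j == i)%:R * meval (fun k => x ord0 k) (mpolyX R (mnm_sub (mnm1 j) (mnm1 i)))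
    = (delta_mx ord0 i : 'rV[R]_m) ord0 j.
    rewrite mxE eqxx /=.
    have [->|//] := eqVneq j i; last by rewrite mul0r.
    rewrite (_ : mnm_sub _ _ = mnm0) ?mpolyX0 ?meval1 ?mulr1//.
    by apply/mnmP => k; rewrite mnmBE subnn mnm0E.
  apply: DeriveDef; first exact/diff_derivable/differentiable_coord.
  rewrite -[in RHS](derive_id x (delta_mx ord0 i)) derive_mx ?mxE//.
suff : D p by [].
elim/mpolyind: p => [|c a p _ _ IH].
  by rewrite -(mpolyC0 m R); exact: DC.
apply: (DD) => //; rewrite -mul_mpolyC; apply: (DM); first exact: DC.
rewrite mpolyXE_id; elim/big_ind: _ => [|q r|j _].
- by rewrite -mpolyC1; exact: DC.
- exact: DM.
elim: (a j) => [|n IHn]; first by rewrite expr0 -mpolyC1; exact: DC.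
by rewrite exprS; exact: DM.
Qed.

Lemma mcoeff0_meval (R : comNzRingType) m (p : mpoly m R) :
  mcoeff mnm0 p = meval (fun=> 0) p.
Proof.
elim/mpolyind: p => [|c a p _ _ IH]; first by rewrite mcoeff0 meval0.
rewrite mcoeffD mevalD -IH mcoeffZ mevalZ; congr (c * _ + _).
rewrite mcoeffX mevalX; have [->|] := eqVneq a mnm0.
  by rewrite big1// => i _; rewrite mnm0E expr0.
move=> a0; have [i ai] : exists i, a i != 0%N.
  apply/existsP; rewrite -negb_forall; apply: contra a0 => /forallP a0.
  by apply/eqP/mnmP => i; rewrite mnm0E; exact/eqP.
by rewrite (bigD1 i)//= expr0n (negbTE ai) mul0r.
Qed.

(** The degree-zero coefficient is the value at 0, which is positive because 0
    lies in the Garding component; the other coefficients are positive multiples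
    of coefficients of partial derivatives. The zero polynomial is included in
    the induction because a partial derivative may vanish. *)
Lemma garding_mcoeff_ge0 (R : realType) m (f : 'rV[R]_m -> R) (p : mpoly m R) a :
  (forall x, f x = meval (fun i => x ord0 i) p) ->
  f = cst 0 \/ garding f /\ garding_component (@nonneg_orthant R m) f 0 ->
  0 <= mcoeff a p.
Proof.
move: {-1}(mdeg a) (erefl (mdeg a)) => d.
elim: d => [|d IH] in a f p * => ad fp f0.
  move/eqP: ad; rewrite mdeg_eq0 => /eqP ->.
  have -> : mcoeff mnm0 p = f 0.
    by rewrite mcoeff0_meval fp; apply: meval_eq => i; rewrite mxE.
  case: f0 => [->//|[_ [C gC C0]]].
  exact/ltW/(is_garding_component_gt0 gC).
have [i ai] : exists i, a i != 0%N.
  apply/existsP; rewrite -negb_forall; apply/negP => /forallP a0.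
  suff a00 : a = mnm0 by rewrite a00 mdeg0 in ad.
  by apply/mnmP => i; rewrite mnm0E; exact/eqP.
have aE : a = mnm_add (mnm_sub a (mnm1 i)) (mnm1 i).
  rewrite submK//; apply/mnm_lepP => j; rewrite mnm1E.
  by have [<-|//] := eqVneq i j; rewrite lt0n.
have Df x : 'D_(delta_mx ord0 i) f x =
    meval (fun j => x ord0 j) (mderiv i p).
  have -> : f = fun y => meval (fun j => y ord0 j) p by exact/funext.
  exact: (derive_val (is_derive := is_derive_meval p i x)).
suff : 0 <= mcoeff (mnm_sub a (mnm1 i)) (mderiv i p).
  by rewrite mcoeff_mderiv -aE pmulrn_lge0.
apply: (IH _ ('D_(delta_mx ord0 i) f)); last 1 first.
- case: f0 => [->|[gf C0]].
    by left; apply/funext => x; exact: derive_cst.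
  have [->|D0] := pselect ('D_(delta_mx ord0 i) f = cst 0); first by left.
  right; case: gf => fpol _ _ gD sD.
  have df := derive_neq0_positive_degree fpol D0.
  have ei : nonneg_orthant (delta_mx ord0 i : 'rV[R]_m).
    by move=> j; rewrite mxE ler0n.
  by split; [exact: gD|exact: sD].
- by move/(congr1 mdeg): aE; rewrite ad mdegD mdeg1 addn1 => -[].
- exact: Df.
Qed.

(** * Cones and nonnegative combinations *)

Lemma closed_convex_coneD (R : realType) (W : finNormedModType R) (K : set W)
    u v : closed_convex_cone K -> K u -> K v -> K (u + v).
Proof.
move=> [_ cK sK] Ku Kv.
have K2 w : K w -> 2 *: w \in K by move=> Kw; rewrite inE; exact: sK.
have h0 : 0 <= 2^-1 :> R by rewrite invr_ge0.
have h1 : 2^-1 <= 1 :> R by rewrite invf_le1 ?ler1n.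
pose h := Itv01 h0 h1.
(* u + v is the midpoint of 2 u and 2 v. *)
have := cK _ _ h (K2 _ Ku) (K2 _ Kv).
move=> /set_mem.
suff -> : conv h (2 *: u : convex_lmodType W) (2 *: v : convex_lmodType W)
  = u + v :> W by [].
transitivity (2^-1 *: (2 *: u) + (1 - 2^-1) *: (2 *: v)); first by [].
by rewrite !scalerA mulrBl mul1r mulVf ?pnatr_eq0// [2 in X in X - 1]mulr2n addrK !scale1r.
Qed.

Definition lincomb (R : realType) (W : finNormedModType R) m (P : 'I_m -> W)
  (x : 'rV[R]_m) : W := \sum_(i < m) x ord0 i *: P i.

Fact lincomb_is_linear (R : realType) (W : finNormedModType R) m
  (P : 'I_m -> W) : linear (lincomb P).
Proof.
move=> t x y; rewrite /lincomb scaler_sumr -big_split /=; apply: eq_bigr => i _.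
by rewrite !mxE scalerDl scalerA.
Qed.

HB.instance Definition _ (R : realType) (W : finNormedModType R) m
    (P : 'I_m -> W) :=
  GRing.isLinear.Build R 'rV[R]_m W _ (lincomb P) (lincomb_is_linear P).

Lemma lincomb_continuous (R : realType) (W : finNormedModType R) m
  (P : 'I_m -> W) : continuous (lincomb P).
Proof.
rewrite /lincomb; elim: (index_enum _) => [|i s IHs].
  by under eq_fun do rewrite big_nil; exact: cst_continuous.
under eq_fun do rewrite big_cons.
have ci : continuous (fun x : 'rV[R]_m => x ord0 i *: P i).
  by move=> x; apply: continuousZr_tmp; exact: coord_continuous.
by move=> x; exact: (continuousD (ci x) (IHs x)).
Qed.

Lemma nonneg_orthant_generating (R : realType) m (x : 'rV[R]_m) :
  exists a b, [/\ nonneg_orthant a, nonneg_orthant b & x = a - b].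
Proof.
exists (\row_j Num.max (x ord0 j) 0), (\row_j Num.max (- x ord0 j) 0).
split=> [j|j|]; rewrite ?mxE ?le_max ?lexx ?orbT//.
apply/rowP => j; rewrite !mxE (ord1 ord0).
by case: leP => ?; case: leP => ?; lra.
Qed.

Lemma interior_segment (R : realType) (W : normedModType R) (K : set W) (s v : W) :
  interior K s -> exists2 e : R, 0 < e & K (s + e *: v).
Proof.
move=> Ks; have gc : (s + e *: v) @[e --> (0 : R)] --> s.
  rewrite -[X in _ --> X]addr0 -[X in _ --> s + X](scale0r v).
  by apply: cvgD; [exact: cvg_cst|exact: scalel_continuous].
have /filter_ex[e []] : \forall e \near 0^'+, K (s + e *: v) /\ 0 < e.
  by apply: filterI; [exact: (cvg_at_right_filter gc)|exact: nbhs_right_gt].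
by move=> Ke e0; exists e.
Qed.

Theorem theorem4p7 (R : realType) (W : finNormedModType R) (K : set W)
    (hK : closed_convex_cone K) (hKproper : K `<` setT)
    (hKint : interior K !=set0)
    (F : W -> R) (hF : garding_for K F)
    (m : nat) (P : 'I_m -> W) (hP : forall i, K (P i)) (A : W) :
  let L : 'rV[R]_m -> W := fun x => A + \sum_(i < m) x ord0 i *: P i in
  let f : 'rV[R]_m -> R := F \o L in
  let C : set W := garding_component K F in
  [/\ range L `&` C !=set0 -> garding f,
      C A \/ interior K (\sum_(i < m) P i) ->
        range L `&` C !=set0 /\ garding f
    & C A -> garding f /\ has_nonneg_coefficients f].
Proof.
move=> L f C.
have K0 : K 0.
  have [k /interior_subset Kk] := hKint.
  by have [_ _ /(_ 0 k (lexx 0) Kk)] := hK; rewrite scale0r.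
have PK (x : 'rV[R]_m) : nonneg_orthant x -> K (lincomb P x).
  move=> x0; rewrite /lincomb; elim/big_ind: _ => // [u v|i _].
    exact: closed_convex_coneD.
  by have [_ _ sK] := hK; exact: sK.
have Js (t : R) (v : 'rV[R]_m) :
    0 <= t -> nonneg_orthant v -> nonneg_orthant (t *: v).
  by move=> t0 v0 j; rewrite mxE mulr_ge0.
have Jg := @nonneg_orthant_generating R m.
have gf : range L `&` C !=set0 -> garding f.
  exact: (garding_for_affine_comp (@lincomb_continuous R W m P) Js Jg PK hF).
have AL : C A -> range L `&` C !=set0.
  move=> CA; exists A; split=> //; exists 0 => //.
  by rewrite /L -/(lincomb P 0) linear0 addr0.
have SL : interior K (\sum_(i < m) P i) -> range L `&` C !=set0.
  (* A far point on the diagonal through A lies in c + K, for c in the component. *)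
  have [_ _ [D gD] _ _] := hF; have [[c Fc Dc] ray] := gD.
  have Ac : D c by rewrite Dc; exact: connected_component_refl.
  move=> /(interior_segment (A - c))[e e0 eK].
  exists (L (const_mx e^-1)); split; first by exists (const_mx e^-1).
  exists D; first exact: gD.
  have -> : L (const_mx e^-1) = c + e^-1 *: (\sum_(i < m) P i + e *: (A - c)).
    rewrite scalerDr scalerA mulVf ?gt_eqF// scale1r [X in c + X]addrC addrA.
    rewrite [c + _]addrC subrK scaler_sumr; congr (A + _).
    by apply: eq_bigr => i _; rewrite mxE.
  apply: ray; first exact: Ac.
  have [_ _ sK] := hK; apply: sK; last exact: eK.
  by rewrite invr_ge0 ltW.
split; first exact: gf.
  move=> CS; have ne : range L `&` C !=set0 by case: CS => [/AL|/SL].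
  by split; [exact: ne|exact: gf].
move=> CA; split; first exact: gf (AL CA).
have [p fp] : exists p : mpoly m R, forall x, f x = meval (fun i => x ord0 i) p.
  have [Fpol _ _ _ _] := hF.
  apply: (@polynomial_function_comp_affine R _ W m F (lincomb P) A _
    (fun i => delta_mx ord0 i)); last exact: Fpol.
  exact: row_sum_delta.
exists p; split; first exact: fp.
move=> a; apply: (garding_mcoeff_ge0 a fp); right.
split; first exact: gf (AL CA).
rewrite (garding_component_affine_comp (@lincomb_continuous R W m P) Js Jg PK).
  by rewrite /preimage /= linear0 addr0.
exact: AL.
Qed.
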